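(* For every positive integer $n$, $$\sup \omega(n, n+2) \;\geq\; \binom{n+1}{2} + 1 + n\sqrt{2\left(1 - \sqrt{\frac{n+1}{2n}}\right)}.$$
   Context: $E^m$ denotes $m$-dimensional Euclidean space and $\|AB\|$ denotes the Euclidean distance between points $A$ and $B$. For a finite point set $S=\{A_1,A_2,\dots,A_k\}\subset E^m$ with $|S|=k$ ($k\ge 2$ distinct points), define $\sigma(S)=\sum_{1\le i<j\le k}\|A_iA_j\|$ (the sum of all pairwise distances) and $D(S)=\max_{1\le i<j\le k}\|A_iA_j\|$ (the diameter). Write $\omega(m,k)=\sigma(S)/D(S)$ for such a set $S$, and define $\sup\omega(m,k)=\max\{\sigma(S)/D(S) \mid S\subset E^m,\ |S|=k\}$, i.e. the supremum of the ratio $\sigma(S)/D(S)$ over all $k$-point subsets $S$ of $E^m$. *)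

(* Defs.v *)
From mathcomp Require Import all_boot all_order all_algebra.
From mathcomp Require Import boolp classical_sets reals.

Set Implicit Arguments.
Unset Strict Implicit.
Unset Printing Implicit Defensive.

Import Order.TTheory GRing.Theory Num.Theory.
Local Open Scope classical_set_scope.
Local Open Scope ring_scope.

(* The Euclidean distance, written out because the library norm on matrices
   is the sup norm. *)
Definition edist (R : realType) (m : nat) (A B : 'rV[R]_m) : R :=
  Num.sqrt (\sum_(i < m) (A 0 i - B 0 i) ^+ 2).

(* A k-point set {A_1, ..., A_k} is given by an enumeration of its points
   without repetition, i.e. an injective S : 'I_k -> 'rV[R]_m; neither
   sigma S nor diam S depends on the enumeration. *)
Definition sigma (R : realType) (m k : nat) (S : 'I_k -> 'rV[R]_m) : R :=
  \sum_(i < k) \sum_(j < k | (i < j)%N) edist (S i) (S j).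

(* Distances are nonnegative, so starting the maximum from 0 does not change
   it when k >= 2. *)
Definition diam (R : realType) (m k : nat) (S : 'I_k -> 'rV[R]_m) : R :=
  \big[Num.max/0]_(i < k) \big[Num.max/0]_(j < k | (i < j)%N)
    edist (S i) (S j).

(* For m >= 1 and k >= 2 this set of ratios is nonempty and bounded above by
   'C(k, 2), so sup is its least upper bound and not the default value 0. *)
Definition sup_omega (R : realType) (m k : nat) : R :=
  sup [set r : R | exists S : 'I_k -> 'rV[R]_m,
                     injective S /\ r = sigma S / diam S].

(* Main.v *)
Require Import Defs.
From mathcomp Require Import all_boot all_order all_algebra.
From mathcomp Require Import boolp classical_sets reals.
From mathcomp Require Import ring lra.

Import Order.TTheory GRing.Theory Num.Theory.
Local Open Scope ring_scope.

(** Take a regular simplex of edge 1 in dimension n and let h be the height of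
    one of its vertices, the apex, above the opposite facet; Pythagoras gives
    h ^ 2 = (n + 1) / (2 * n).  The last point is put on the axis of the simplex
    through the apex, on the ray from the apex to the centroid of that facet, at
    distance t <= 1 from the apex.  It lies at signed height t - h over the
    facet, counted positive away from the apex, and the vertices of the facet are
    at squared distance 1 - h ^ 2 from their centroid, so its distance to each of these n vertices is
    sqrt ((t - h) ^ 2 + 1 - h ^ 2).  This is at most 1 because t <= 1 < 2 * h.
    Hence the n + 2 points have diameter 1, and the sum of their distances is
    'C(n + 1, 2) + t + n * sqrt ((t - h) ^ 2 + 1 - h ^ 2)
    ([simplex_and_axis_point_le_sup_omega]).

    For n > 1, the value t = 1 gives the bound.  For n = 1, the value t = 1
    would put the last point on a vertex; but then h = 1 and every t in ]0, 1[ gives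
    the same sum, so t = 1 / 2 is used.

    Passing from one configuration to the supremum uses that the ratios are
    bounded, each distance being at most the diameter
    ([sigma_le_sup_omega]). *)

(** * Distances, diameter and the supremum of the ratios *)

Lemma edist_ge0 (R : realType) (m : nat) (A B : 'rV[R]_m) : 0 <= edist A B.
Proof. exact: sqrtr_ge0. Qed.

Lemma edistxx (R : realType) (m : nat) (A : 'rV[R]_m) : edist A A = 0.
Proof. by rewrite /edist big1 ?sqrtr0 // => i _; rewrite subrr expr0n. Qed.

Lemma edist_le_diam (R : realType) (m k : nat) (S : 'I_k -> 'rV[R]_m)
  (i j : 'I_k) : (i < j)%N -> edist (S i) (S j) <= diam S.
Proof.
move=> ltij; rewrite /diam.
by apply: (bigmax_sup i) => //; apply: (bigmax_sup j).
Qed.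

Lemma diam_le (R : realType) (m k : nat) (S : 'I_k -> 'rV[R]_m) (D : R) :
  0 <= D -> (forall i j : 'I_k, (i < j)%N -> edist (S i) (S j) <= D) ->
  diam S <= D.
Proof.
by move=> D0 leD; apply: bigmax_le => // i _; apply: bigmax_le => // j; apply: leD.
Qed.

Lemma diam_ge0 (R : realType) (m k : nat) (S : 'I_k -> 'rV[R]_m) : 0 <= diam S.
Proof. exact: bigmax_ge_id. Qed.

Lemma sigma_div_diam_le (R : realType) (m k : nat) (S : 'I_k -> 'rV[R]_m) :
  sigma S / diam S <= \sum_(i < k) \sum_(j < k | (i < j)%N) 1.
Proof.
have [D0|Dneq0] := eqVneq (diam S) 0.
  by rewrite D0 invr0 mulr0; do 2![apply: sumr_ge0 => ? _].
rewrite ler_pdivrMr; last by rewrite lt_neqAle eq_sym Dneq0 diam_ge0.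
rewrite mulr_suml; apply: ler_sum => i _.
rewrite mulr_suml; apply: ler_sum => j ltij.
by rewrite mul1r edist_le_diam.
Qed.

Lemma edist_gt0_inj (R : realType) (m k : nat) (S : 'I_k -> 'rV[R]_m) :
  (forall i j : 'I_k, (i < j)%N -> 0 < edist (S i) (S j)) -> injective S.
Proof.
move=> pos i j eqS; apply/val_inj; case: (ltngtP i j) => // /pos.
  by rewrite eqS edistxx ltxx.
by rewrite eqS edistxx ltxx.
Qed.

Lemma sigma_le_sup_omega (R : realType) (m k : nat) (S : 'I_k -> 'rV[R]_m)
  (i0 j0 : 'I_k) :
  (i0 < j0)%N ->
  (forall i j : 'I_k, (i < j)%N -> 0 < edist (S i) (S j) <= 1) ->
  sigma S <= sup_omega R m k.
Proof.
move=> lt0 dist01.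
have D1 : diam S <= 1 by apply: diam_le => // i j /dist01/andP[].
have D0 : 0 < diam S.
  by have /andP[pos _] := dist01 _ _ lt0; apply: lt_le_trans pos _; apply: edist_le_diam.
have sig0 : 0 <= sigma S.
  by apply: sumr_ge0 => i _; apply: sumr_ge0 => j _; apply: edist_ge0.
apply: (@le_trans _ _ (sigma S / diam S)).
  by rewrite ler_pdivlMr // ler_piMr.
apply: ub_le_sup.
  exists (\sum_(i < k) \sum_(j < k | (i < j)%N) 1) => _ [T [_ ->]].
  exact: sigma_div_diam_le.
by exists S; split=> //; apply: edist_gt0_inj => i j /dist01/andP[].
Qed.

(** * Sums over pairs of indices *)

Lemma sum_pairs_recr (V : nmodType) (w : nat -> nat -> V) (k : nat) :
  \sum_(i < k.+1) \sum_(j < k.+1 | (i < j)%N) w i j =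
  \sum_(i < k) \sum_(j < k | (i < j)%N) w i j + \sum_(i < k) w i k.
Proof.
rewrite big_ord_recr /= [X in _ + X]big_pred0 ?addr0; last first.
  by move=> j; rewrite ltnNge -ltnS ltn_ord.
rewrite -big_split; apply: eq_bigr => i _ /=.
by rewrite big_mkcond big_ord_recr /= ltn_ord -big_mkcond.
Qed.

Lemma sum_pairs_const1 (R : pzSemiRingType) (k : nat) :
  \sum_(i < k) \sum_(j < k | (i < j)%N) 1 = 'C(k, 2)%:R :> R.
Proof.
elim: k => [|k IHk]; first by rewrite big_ord0.
by rewrite (sum_pairs_recr R (fun _ _ => 1)) IHk sumr_const card_ord binS bin1 natrD.
Qed.

(** * A regular simplex and its axis *)

Section Simplex.

Variables (R : realType) (n : nat).
Hypothesis n_gt0 : (0 < n)%N.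

Definition simplex_height : R := Num.sqrt ((n%:R + 1) / (2 * n%:R)).

Local Notation h := simplex_height.
Local Notation s := (Num.sqrt 2^-1 : R).
Local Notation u := (Num.sqrt n%:R^-1 : R).

(** The facet is spanned by the multiples of the n standard basis vectors that
    are at mutual distance 1. *)
Definition facet_vertex (k : nat) : 'rV[R]_n := \row_j (s * (val j == k)%:R).

(** The diagonal is the line perpendicular to the facet at its centroid, which
    is the point with x = 0; u is the common coordinate of a unit vector on the
    diagonal, so that x is the signed height over the facet. *)
Definition axis_point (x : R) : 'rV[R]_n := const_mx (s / n%:R + x * u).

Let n_neq0 : n%:R != 0 :> R. Proof. by rewrite pnatr_eq0 -lt0n. Qed.

Let n_ge1 : 1 <= n%:R :> R. Proof. by rewrite ler1n. Qed.

Let s_sqr : s ^+ 2 = 2^-1. Proof. by rewrite sqr_sqrtr // invr_ge0. Qed.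

Let u_sqr : u ^+ 2 = n%:R^-1. Proof. by rewrite sqr_sqrtr // invr_ge0. Qed.

Lemma simplex_height_sqr : h ^+ 2 = (n%:R + 1) / (2 * n%:R).
Proof. by rewrite sqr_sqrtr // divr_ge0 ?addr_ge0 ?mulr_ge0. Qed.

Lemma simplex_height_le1 : h <= 1.
Proof.
rewrite -[leRHS]sqrtr1; apply: ler_wsqrtr.
by rewrite ler_pdivrMr; have := n_ge1; lra.
Qed.

Lemma simplex_height_lt1 : (1 < n)%N -> h < 1.
Proof.
rewrite -(ltr1n R) => n1; rewrite -[ltRHS]sqrtr1 ltr_sqrt //.
by rewrite ltr_pdivrMr; lra.
Qed.

Lemma simplex_height_gt_half : 1 < 2 * h.
Proof.
have h0 : 0 <= h by apply: sqrtr_ge0.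
have hh : 1 < 2 * h ^+ 2.
  by rewrite simplex_height_sqr mulrA ltr_pdivlMr; have := n_ge1; lra.
have := simplex_height_le1; nra.
Qed.

Lemma edist_facet_vertices (i j : 'I_n) :
  i != j -> edist (facet_vertex i) (facet_vertex j) = 1.
Proof.
move=> neq; rewrite /edist (bigD1 i) //= (bigD1 j) 1?eq_sym //= big1.
  rewrite !mxE !eqxx [(i : nat) == j](negPf neq) [(j : nat) == i]eq_sym.
  rewrite [(i : nat) == j](negPf neq) !mulr1 !mulr0 subr0 sub0r sqrrN s_sqr addr0.
  by rewrite (_ : 2^-1 + 2^-1 = 1) ?sqrtr1 //; field.
move=> l /andP[li lj]; rewrite !mxE.
by rewrite [(l : nat) == i](negPf li) [(l : nat) == j](negPf lj) subrr expr0n.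
Qed.

(** Pythagoras: the vertices of the facet are at squared distance 1 - h ^ 2 from
    its centroid. *)
Lemma edist_facet_vertex_axis (i : 'I_n) (x : R) :
  edist (facet_vertex i) (axis_point x) = Num.sqrt (x ^+ 2 + 1 - h ^+ 2).
Proof.
rewrite /edist (bigD1 i) //= (eq_bigr (fun=> (s / n%:R + x * u) ^+ 2)); last first.
  move=> l li; rewrite !mxE [(l : nat) == i](negPf li) mulr0 sub0r sqrrN //.
rewrite sumr_const cardC1 card_ord !mxE eqxx mulr1 simplex_height_sqr.
congr Num.sqrt; rewrite -[X in _ + X]mulr_natl.
have -> : n.-1%:R = n%:R - 1 :> R by rewrite -subn1 natrB.
(* The mixed terms s * u cancel, as the centroid of the facet is the foot of the
   perpendicular. *)
transitivity (s ^+ 2 * (1 - n%:R^-1) + x ^+ 2 * (n%:R * u ^+ 2)).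
  by field.
by rewrite s_sqr u_sqr; field.
Qed.

Lemma edist_axis (x y : R) : edist (axis_point x) (axis_point y) = `|x - y|.
Proof.
rewrite /edist (eq_bigr (fun=> (x - y) ^+ 2 * u ^+ 2)); last first.
  by move=> l _; rewrite !mxE; ring.
rewrite sumr_const card_ord u_sqr -[X in Num.sqrt X]mulr_natl.
rewrite mulrCA mulfV // mulr1.
exact: sqrtr_sqr.
Qed.

(** * The simplex together with a point of its axis *)

(** Index n is the apex of the simplex, and index n + 1 is the point at distance
    t from it towards the facet. *)
Definition simplex_and_axis_point (t : R) (k : nat) : 'rV[R]_n :=
  if (k < n)%N then facet_vertex k
  else axis_point (if k == n then - h else t - h).

Definition simplex_and_axis_dist (t : R) (i j : nat) : R :=
  if (j <= n)%N then 1
  else if (i < n)%N then Num.sqrt ((t - h) ^+ 2 + 1 - h ^+ 2) else t.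

Lemma edist_simplex_and_axis_point (t : R) (i j : 'I_n.+2) :
  0 < t -> (i < j)%N ->
  edist (simplex_and_axis_point t i) (simplex_and_axis_point t j) =
  simplex_and_axis_dist t i j.
Proof.
move=> t0 ltij; rewrite /simplex_and_axis_point /simplex_and_axis_dist.
have [ltjn|ltnj|eqj] := ltngtP j n.
- have ltin := ltn_trans ltij ltjn; rewrite ltin.
  apply: (edist_facet_vertices (Ordinal ltin) (Ordinal ltjn)).
  by rewrite -val_eqE /= ltn_eqF.
- case: (ltnP i n) => [ltin|leni].
    exact: (edist_facet_vertex_axis (Ordinal ltin)).
  have -> : i = n :> nat.
    by apply/eqP; rewrite eqn_leq leni andbT -ltnS (leq_trans ltij) // -ltnS.
  by rewrite eqxx edist_axis (_ : - h - (t - h) = - t) ?normrN ?gtr0_norm //; ring.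
- have ltin : (i < n)%N by move: ltij; rewrite eqj.
  rewrite ltin (edist_facet_vertex_axis (Ordinal ltin)) sqrrN.
  by rewrite addrAC subrr add0r sqrtr1.
Qed.

Lemma sum_simplex_and_axis_dist (t : R) :
  \sum_(i < n.+2) \sum_(j < n.+2 | (i < j)%N) simplex_and_axis_dist t i j =
  'C(n.+1, 2)%:R + t + n%:R * Num.sqrt ((t - h) ^+ 2 + 1 - h ^+ 2).
Proof.
rewrite sum_pairs_recr -sum_pairs_const1 -addrA; congr (_ + _).
  apply: eq_bigr => i _; apply: eq_bigr => j _.
  by rewrite /simplex_and_axis_dist -ltnS ltn_ord.
rewrite big_ord_recr /= addrC; congr (_ + _).
  by rewrite /simplex_and_axis_dist !ltnn.
rewrite (eq_bigr (fun=> Num.sqrt ((t - h) ^+ 2 + 1 - h ^+ 2))).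
  by rewrite sumr_const card_ord mulr_natl.
by move=> i _; rewrite /simplex_and_axis_dist ltnn /= ltn_ord.
Qed.

(** The positivity hypothesis says that the last point is not a vertex of the
    facet. *)
Lemma simplex_and_axis_point_le_sup_omega (t : R) :
  0 < t <= 1 -> 0 < (t - h) ^+ 2 + 1 - h ^+ 2 ->
  'C(n.+1, 2)%:R + t + n%:R * Num.sqrt ((t - h) ^+ 2 + 1 - h ^+ 2)
    <= sup_omega R n n.+2.
Proof.
move=> /andP[t0 t1] d0.
pose S (i : 'I_n.+2) := simplex_and_axis_point t i.
have dist (i j : 'I_n.+2) : (i < j)%N ->
    edist (S i) (S j) = simplex_and_axis_dist t i j.
  exact: edist_simplex_and_axis_point.
have <- : sigma S =
    'C(n.+1, 2)%:R + t + n%:R * Num.sqrt ((t - h) ^+ 2 + 1 - h ^+ 2).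
  rewrite -sum_simplex_and_axis_dist.
  by apply: eq_bigr => i _; apply: eq_bigr => j; apply: dist.
apply: (@sigma_le_sup_omega _ _ _ _ ord0 ord_max) => // i j ltij.
rewrite dist // /simplex_and_axis_dist; case: ifP => _; first by rewrite ltr01 lexx.
case: ifP => _; last by rewrite t0.
rewrite sqrtr_gt0 d0 /= -[leRHS]sqrtr1; apply: ler_wsqrtr.
have := simplex_height_gt_half; nra.
Qed.

End Simplex.

Theorem theorem3p3 (R : realType) (n : nat) (hn : (0 < n)%N) :
  sup_omega R n (n + 2) >=
    'C(n + 1, 2)%:R + 1
      + n%:R * Num.sqrt (2 * (1 - Num.sqrt ((n%:R + 1) / (2 * n%:R)))).
Proof.
rewrite addn1 addn2 -/(simplex_height R n).
have [n1|n1] := ltnP 1 n.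
  have h1 := simplex_height_lt1 R n n1.
  have dE : (1 - simplex_height R n) ^+ 2 + 1 - simplex_height R n ^+ 2 =
      2 * (1 - simplex_height R n) by ring.
  rewrite -dE; apply: simplex_and_axis_point_le_sup_omega => //.
    by rewrite ltr01 lexx.
  by rewrite dE; lra.
have {hn n1} -> : n = 1%N by apply/eqP; rewrite eqn_leq n1.
have h1 : simplex_height R 1 = 1.
  by rewrite /simplex_height (_ : _ / _ = 1) ?sqrtr1 //; field.
have le_sup := @simplex_and_axis_point_le_sup_omega R 1 isT 2^-1.
rewrite h1 (_ : (2^-1 - 1) ^+ 2 + 1 - 1 ^+ 2 = 2^-1 ^+ 2) in le_sup; last by field.
rewrite h1 subrr mulr0 sqrtr0 mulr0 addr0.
apply: le_trans (le_sup _ _); last 2 first.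
- by apply/andP; split; lra.
- by rewrite exprn_gt0 // invr_gt0.
by rewrite sqrtr_sqr ger0_norm ?invr_ge0 //; lra.
Qed.
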